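(* Let $R>0$, $a>0$, $\lambda_1\in\mathbb R\setminus\{0\}$, $\lambda\in\mathbb R$, and consider the equations of motion of a circular cylinder and one point vortex in a perfect fluid (written out in the context). The absolute motion of the cylinder is bounded except maybe in the two cases (1) $\lambda=\lambda_1$; (2) $\lambda=0$. That is, if $\lambda\ne\lambda_1$ and $\lambda\neq0$, then for every solution $\mathbf r_c(t)$ is a bounded function of time on the interval of existence of the solution.
   Context: Setting: a cylinder (disk) of radius $R$ in the plane with center $\mathbf r_c=(x_c,y_c)$ (in a fixed frame) and velocity $\mathbf v=(v_1,v_2)$; $\mathbf r_1=(x_1,y_1)$ is the vector from the center of the cylinder to the vortex; $\tilde{\mathbf r}_1=(\tilde x_1,\tilde y_1)=\frac{R^2}{|\mathbf r_1|^2}\mathbf r_1$ is the vector from the center of the cylinder to the inverse point. The constants are $a$ (involving the added mass), $\lambda$ (related to the circulation around the cylinder) and $\lambda_1$ (vortex strength). ''Absolute motion'' means motion with respect to the fixed frame. Phase space: $M=\{(x_c,y_c,v_1,v_2,x_1,y_1)\in\mathbb R^{6}: |\mathbf r_1|>R\}$. Let, for $\mathbf r=(x,y)$ with $|\mathbf r|>R$ (multivalued, but with single-valued gradient), $$\tilde\varphi_1(\mathbf r)=-\frac{R^2}{|\mathbf r|^2}(\mathbf r,\mathbf v)-\lambda\arctan\frac yx+\lambda_1\arctan\frac{y-\tilde y_1}{x-\tilde x_1}$$ (the part of the velocity potential without singularity at $\mathbf r=\mathbf r_1$; the gradient is taken in $\mathbf r$ with $\tilde{\mathbf r}_1$ fixed).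 Equations of motion: $$\dot{\mathbf r}_1=-\mathbf v+\operatorname{grad}\tilde\varphi_1\big|_{\mathbf r=\mathbf r_1},\qquad \dot{\mathbf r}_c=\mathbf v,$$ $$a\dot v_1=\lambda v_2-\lambda_1(\dot{\tilde y}_1-\dot y_1),\qquad a\dot v_2=-\lambda v_1+\lambda_1(\dot{\tilde x}_1-\dot x_1),$$ where $\dot{\tilde x}_1,\dot{\tilde y}_1$ are time derivatives of $\tilde x_1,\tilde y_1$, expressed through $\mathbf r_1$ and $\dot{\mathbf r}_1$. *)

(* Defs.v *)
From Stdlib Require Import Reals.
From Coquelicot Require Import Coquelicot.
Open Scope R_scope.

(* [th] is a continuous branch, near [(x, y)], of the multivalued function
   arctan (y / x).  The equation [u * sin (th u v) = v * cos (th u v)] is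
   tan (th u v) = v / u cleared of its denominator, so that the points of the
   line u = 0 (other than the origin) are allowed. *)
Definition arctan_branch (th : R -> R -> R) (x y : R) : Prop :=
  locally_2d (fun u v =>
    continuity_2d_pt th u v /\ u * sin (th u v) = v * cos (th u v)) x y.

(* The inverse point of [(x, y)] in the circle of radius [rad] centred at 0. *)
Definition inv_x (rad x y : R) : R := rad ^ 2 / (x ^ 2 + y ^ 2) * x.
Definition inv_y (rad x y : R) : R := rad ^ 2 / (x ^ 2 + y ^ 2) * y.

(* [phi] is a branch, near [(x, y)], of the regular part of the velocity
   potential; [(xt, yt)] is the inverse point, kept fixed. *)
Definition potential_branch (rad lam lam1 v1 v2 xt yt : R)
    (phi : R -> R -> R) (x y : R) : Prop :=
  exists th0 th1 : R -> R -> R,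
    arctan_branch th0 x y /\
    arctan_branch th1 (x - xt) (y - yt) /\
    forall u w : R,
      phi u w = - (rad ^ 2 / (u ^ 2 + w ^ 2)) * (u * v1 + w * v2)
                - lam * th0 u w + lam1 * th1 (u - xt) (w - yt).

(* [(gx, gy)] is the gradient at [(x, y)] of the multivalued potential: that of
   any of its branches, two branches near [(x, y)] differing by a constant. *)
Definition is_grad_potential (rad lam lam1 v1 v2 xt yt x y gx gy : R) : Prop :=
  exists phi : R -> R -> R,
    potential_branch rad lam lam1 v1 v2 xt yt phi x y /\
    differentiable_pt_lim phi x y gx gy.

(* The position of the centre of the cylinder, its velocity, and the vector from
   that centre to the vortex, as functions of time. *)
Record motion : Type := Motion {
  xc : R -> R; yc : R -> R;
  v1 : R -> R; v2 : R -> R;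
  x1 : R -> R; y1 : R -> R
}.

Definition eqs_of_motion (rad a lam lam1 : R) (m : motion) (t : R) : Prop :=
  let xt := fun s => inv_x rad (x1 m s) (y1 m s) in
  let yt := fun s => inv_y rad (x1 m s) (y1 m s) in
  (exists gx gy : R,
     is_grad_potential rad lam lam1 (v1 m t) (v2 m t) (xt t) (yt t)
       (x1 m t) (y1 m t) gx gy /\
     is_derive (x1 m) t (- v1 m t + gx) /\
     is_derive (y1 m) t (- v2 m t + gy)) /\
  is_derive (xc m) t (v1 m t) /\
  is_derive (yc m) t (v2 m t) /\
  ex_derive (v1 m) t /\
  ex_derive (v2 m) t /\
  a * Derive (v1 m) t
    = lam * v2 m t - lam1 * (Derive yt t - Derive (y1 m) t) /\
  a * Derive (v2 m) t
    = - lam * v1 m t + lam1 * (Derive xt t - Derive (x1 m) t).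

(* [m] is a solution in the phase space |r_1| > rad on the (possibly unbounded)
   open time interval from [alpha] to [beta]. *)
Definition is_solution (rad a lam lam1 : R) (alpha beta : Rbar) (m : motion)
    : Prop :=
  forall t : R, Rbar_lt alpha t -> Rbar_lt t beta ->
    rad < sqrt (x1 m t ^ 2 + y1 m t ^ 2) /\
    eqs_of_motion rad a lam lam1 m t.

(* Main.v *)
(** Write [z] for the vector to the vortex, [rho = |z|^2], [V] for the velocity
    of the cylinder and [q] for the inverse point minus [z], all as complex
    numbers, and let [P = a V - i lam1 q].  The equations of motion have the
    integrals
      [P + i lam r_c],
      [|P|^2 - lam lam1 rho],
      [a |V|^2 + lam1^2 ln (rho - rad^2) - lam lam1 ln rho].
    By the first two, [r_c] is bounded as soon as [rho] is.  By the third,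
    [|V|^2] grows at most logarithmically in [rho], so that for large [rho] the
    leading part of [|P|^2] is [lam1^2 |q|^2 ~ lam1^2 rho]; as
    [lam1^2 <> lam lam1], the second integral then bounds [rho]. *)
Require Import Defs.
From Stdlib Require Import Reals Lra Psatz Classical.
From Coquelicot Require Import Coquelicot.
Open Scope R_scope.

(** * The gradient of the multivalued potential *)

(* [th - th0] is the angle from [(x, y)] to [(u, v)], up to a multiple of PI. *)
Lemma branch_eq_atan (th0 th u v x y : R) :
  x * sin th0 = y * cos th0 -> u * sin th = v * cos th ->
  Rabs (th - th0) < PI / 2 -> 0 < u * x + v * y ->
  th = th0 + atan ((v * x - u * y) / (u * x + v * y)).
Proof.
intros e0 e hclose hpos.
apply Rabs_def2 in hclose.
assert (hc : 0 < cos (th - th0)) by (apply cos_gt_0; lra).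
(* By [e0] and [e], [(x, y)] and [(u, v)] are multiples, of either sign, of the unit vectors at
   angles [th0] and [th]; the identity compares their cross and dot products. *)
assert (hsc : sin (th - th0) * (u * x + v * y)
              = cos (th - th0) * (v * x - u * y)).
{ rewrite sin_minus, cos_minus.
  transitivity
    (cos th0 * x * (u * sin th) + (x * sin th0) * (- (cos th) * u)
     + v * y * (sin th * cos th0) - y * sin th0 * (v * cos th)); [ring|].
  rewrite <- e, e0.
  transitivity
    (cos th0 * x * (u * sin th) - u * y * cos th * cos th0
     + v * sin th * (y * cos th0) - u * y * sin th * sin th0); [ring|].
  rewrite <- e0, e. ring. }
replace ((v * x - u * y) / (u * x + v * y)) with (tan (th - th0)).
- rewrite atan_tan; lra.
- unfold tan. apply (Rmult_eq_reg_r (cos (th - th0) * (u * x + v * y))).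
  + transitivity (sin (th - th0) * (u * x + v * y)); [field; lra|].
    rewrite hsc. field. lra.
  + apply Rgt_not_eq, Rmult_lt_0_compat; lra.
Qed.

(** A branch is only assumed continuous; this local formula in terms of [atan] is what makes it
    differentiable. *)
Lemma arctan_branch_near (th : R -> R -> R) (x y : R) :
  0 < x ^ 2 + y ^ 2 -> arctan_branch th x y ->
  locally_2d (fun u v => th u v
    = th x y + atan ((v * x - u * y) / (u * x + v * y))) x y.
Proof.
intros hpos hth.
destruct (locally_2d_singleton _ _ _ hth) as [hcont e0].
assert (hpi : 0 < PI / 2) by (pose proof PI_RGT_0; lra).
assert (hin : continuity_2d_pt (fun u v => u * x + v * y) x y).
{ apply continuity_2d_pt_plus; apply continuity_2d_pt_mult;
    auto using continuity_2d_pt_id1, continuity_2d_pt_id2,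
      continuity_2d_pt_const. }
(* The tolerance [PI / 2] excludes jumps by multiples of [PI]; the tolerance [x ^ 2 + y ^ 2], the
   value of the dot product at [(x, y)], keeps that product positive. *)
pose proof (hcont (mkposreal _ hpi)) as h1.
pose proof (hin (mkposreal _ hpos)) as h2.
generalize (locally_2d_and _ _ _ _ hth (locally_2d_and _ _ _ _ h1 h2)).
apply locally_2d_impl, locally_2d_forall.
intros u v ((_ & e) & hclose & hdot); simpl in hclose, hdot.
apply branch_eq_atan; trivial.
apply Rabs_def2 in hdot. lra.
Qed.

Lemma arctan_branch_derive (th : R -> R -> R) (x y : R) :
  0 < x ^ 2 + y ^ 2 -> arctan_branch th x y ->
  is_derive (fun u : R => th u y) x (- y / (x ^ 2 + y ^ 2)) /\
  is_derive (fun v : R => th x v) y (x / (x ^ 2 + y ^ 2)).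
Proof.
intros hpos hth.
pose proof (arctan_branch_near th x y hpos hth) as h.
split.
- apply is_derive_ext_loc with
    (fun u => th x y + atan ((y * x - u * y) / (u * x + y * y))).
  + generalize (locally_2d_1d_const_y _ _ _ h). apply filter_imp.
    intros u hu. now symmetry.
  + auto_derive; [nra|]. field. repeat split; nra.
- apply is_derive_ext_loc with
    (fun v => th x y + atan ((v * x - x * y) / (x * x + v * y))).
  + generalize (locally_2d_1d_const_x _ _ _ h). apply filter_imp.
    intros v hv. now symmetry.
  + auto_derive; [nra|]. field. repeat split; nra.
Qed.

(** The inverse point lies on the line through 0 and [(x, y)], so both arctangents have gradients
    along [(- y, x)], and their coefficients combine into [- g]. *)
Lemma grad_potential (rad lam lam1 v1 v2 x y gx gy : R) :
  0 < rad -> rad ^ 2 < x ^ 2 + y ^ 2 ->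
  is_grad_potential rad lam lam1 v1 v2 (inv_x rad x y) (inv_y rad x y)
    x y gx gy ->
  let rho := x ^ 2 + y ^ 2 in
  let g := lam / rho - lam1 / (rho - rad ^ 2) in
  gx = rad ^ 2 * (v1 * (x ^ 2 - y ^ 2) + 2 * x * y * v2) / rho ^ 2 + g * y /\
  gy = rad ^ 2 * (2 * x * y * v1 - v2 * (x ^ 2 - y ^ 2)) / rho ^ 2 - g * x.
Proof.
intros hrad hout (phi & (th0 & th1 & hth0 & hth1 & hphi) & hgrad) rho g.
assert (hr2 : 0 < rad ^ 2) by nra.
assert (hrho : 0 < rho) by (unfold rho; lra).
(* The vector from the inverse point to the vortex is [k] times [(x, y)], and
   [k * rho = rho - rad ^ 2]. *)
set (k := 1 - rad ^ 2 / rho).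
assert (hk : 0 < k).
{ unfold k. replace (1 - rad ^ 2 / rho) with ((rho - rad ^ 2) / rho)
    by (field; lra).
  apply Rdiv_lt_0_compat; unfold rho in *; lra. }
assert (ex : x - inv_x rad x y = k * x)
  by (unfold inv_x, k; fold rho; ring).
assert (ey : y - inv_y rad x y = k * y)
  by (unfold inv_y, k; fold rho; ring).
assert (hkrho : rho - rad ^ 2 = k * rho) by (unfold k; field; lra).
assert (hden : (k * x) ^ 2 + (k * y) ^ 2 = k ^ 2 * rho) by (unfold rho; ring).
assert (hpos1 : 0 < (x - inv_x rad x y) ^ 2 + (y - inv_y rad x y) ^ 2).
{ rewrite ex, ey, hden.
  apply Rmult_lt_0_compat; trivial. now apply pow_lt. }
destruct (arctan_branch_derive _ _ _ hrho hth0) as [d0x d0y].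
destruct (arctan_branch_derive _ _ _ hpos1 hth1) as [d1x d1y].
assert (e1x : - (y - inv_y rad x y) /
    ((x - inv_x rad x y) ^ 2 + (y - inv_y rad x y) ^ 2)
  = - y / (rho - rad ^ 2)).
{ rewrite ex, ey, hkrho, hden. field. lra. }
assert (e1y : (x - inv_x rad x y) /
    ((x - inv_x rad x y) ^ 2 + (y - inv_y rad x y) ^ 2)
  = x / (rho - rad ^ 2)).
{ rewrite ex, ey, hkrho, hden. field. lra. }
rewrite e1x in d1x. rewrite e1y in d1y.
destruct (differentiable_pt_lim_unique _ _ _ _ _ hgrad) as [<- <-].
fold rho in d0x, d0y.
split; apply is_derive_unique.
- apply is_derive_ext with (fun u =>
    - (rad ^ 2 / (u ^ 2 + y ^ 2)) * (u * v1 + y * v2) - lam * th0 u y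
    + lam1 * th1 (u - inv_x rad x y) (y - inv_y rad x y)).
  { intros u. now rewrite hphi. }
  auto_derive.
  + repeat split; [unfold rho in *; nra | eexists; exact d0x |
      eexists; exact d1x].
  + rewrite (is_derive_unique _ _ _ d0x).
    change (x + - inv_x rad x y) with (x - inv_x rad x y).
    rewrite (is_derive_unique _ _ _ d1x).
    unfold g, rho in *. field. lra.
- apply is_derive_ext with (fun w =>
    - (rad ^ 2 / (x ^ 2 + w ^ 2)) * (x * v1 + w * v2) - lam * th0 x w
    + lam1 * th1 (x - inv_x rad x y) (w - inv_y rad x y)).
  { intros w. now rewrite hphi. }
  auto_derive.
  + repeat split; [unfold rho in *; nra | eexists; exact d0y |
      eexists; exact d1y].
  + rewrite (is_derive_unique _ _ _ d0y).
    change (y + - inv_y rad x y) with (y - inv_y rad x y).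
    rewrite (is_derive_unique _ _ _ d1y).
    unfold g, rho in *. field. lra.
Qed.

(** * The first integrals *)

Definition rho (m : motion) (t : R) : R := x1 m t ^ 2 + y1 m t ^ 2.

(* The two components of [P]. *)
Definition mom_x (rad a lam1 : R) (m : motion) (t : R) : R :=
  a * v1 m t + lam1 * (inv_y rad (x1 m t) (y1 m t) - y1 m t).
Definition mom_y (rad a lam1 : R) (m : motion) (t : R) : R :=
  a * v2 m t - lam1 * (inv_x rad (x1 m t) (y1 m t) - x1 m t).

Definition energy (rad a lam lam1 : R) (m : motion) (t : R) : R :=
  a * (v1 m t ^ 2 + v2 m t ^ 2) + lam1 ^ 2 * ln (rho m t - rad ^ 2)
  - lam * lam1 * ln (rho m t).

Lemma square_lt_of_lt_sqrt (c r : R) : 0 <= c -> c < sqrt r -> c ^ 2 < r.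
Proof.
intros hc h.
assert (hr : 0 < r).
{ apply sqrt_lt_0_alt. rewrite sqrt_0. lra. }
rewrite <- (pow2_sqrt r) by lra. nra.
Qed.

(** The equations for the velocity say [P' = - i lam V], which gives the first two integrals. In the
    derivative of [|P|^2] the part [a V] of [P] drops out, and the rest is [lam lam1 rho']. In the
    energy the force proportional to [lam] is orthogonal to [V] and does no work; the remaining
    terms cancel once the vortex velocity is substituted. *)
Lemma integrals_derive (rad a lam lam1 : R) (m : motion) (t : R) :
  0 < rad -> a <> 0 -> rad ^ 2 < rho m t ->
  eqs_of_motion rad a lam lam1 m t ->
  is_derive (fun s => mom_x rad a lam1 m s - lam * yc m s) t 0 /\
  is_derive (fun s => mom_y rad a lam1 m s + lam * xc m s) t 0 /\
  is_derive (fun s => mom_x rad a lam1 m s ^ 2 + mom_y rad a lam1 m s ^ 2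
                      - lam * lam1 * rho m s) t 0 /\
  is_derive (energy rad a lam lam1 m) t 0.
Proof.
intros hrad ha hrho
  ((gx & gy & hg & dx & dy) & dxc & dyc & ev1 & ev2 & e1 & e2).
assert (hr2 : 0 < rad ^ 2) by nra.
destruct (grad_potential _ _ _ _ _ _ _ _ _ hrad hrho hg) as [-> ->].
change (x1 m t ^ 2 + y1 m t ^ 2) with (rho m t) in dx, dy.
match type of dx with is_derive _ _ ?d => set (dx' := d) in dx end.
match type of dy with is_derive _ _ ?d => set (dy' := d) in dy end.
set (drho := 2 * (x1 m t * dx' + y1 m t * dy')).
assert (Dx : Derive (fun s => x1 m s) t = dx')
  by exact (is_derive_unique _ _ _ dx).
assert (Dy : Derive (fun s => y1 m s) t = dy')
  by exact (is_derive_unique _ _ _ dy).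
assert (Dxc : Derive (fun s => xc m s) t = v1 m t)
  by exact (is_derive_unique _ _ _ dxc).
assert (Dyc : Derive (fun s => yc m s) t = v2 m t)
  by exact (is_derive_unique _ _ _ dyc).
assert (dxt : is_derive (fun s : R => inv_x rad (x1 m s) (y1 m s)) t
  (rad ^ 2 * (dx' * rho m t - x1 m t * drho) / rho m t ^ 2)).
{ unfold inv_x, rho in *. auto_derive.
  - repeat split; [eexists; exact dx | eexists; exact dy | nra |
      eexists; exact dx].
  - rewrite Dx, Dy.
    unfold drho. clearbody dx' dy'. field. lra. }
assert (dyt : is_derive (fun s : R => inv_y rad (x1 m s) (y1 m s)) t
  (rad ^ 2 * (dy' * rho m t - y1 m t * drho) / rho m t ^ 2)).
{ unfold inv_y, rho in *. auto_derive.
  - repeat split; [eexists; exact dx | eexists; exact dy | nra |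
      eexists; exact dy].
  - rewrite Dx, Dy.
    unfold drho. clearbody dx' dy'. field. lra. }
rewrite (is_derive_unique _ _ _ dyt) in e1.
rewrite (is_derive_unique _ _ _ dxt) in e2.
change (Derive (y1 m) t) with (Derive (fun s => y1 m s) t) in e1.
change (Derive (x1 m) t) with (Derive (fun s => x1 m s) t) in e2.
change (Derive (v1 m) t) with (Derive (fun s => v1 m s) t) in e1.
change (Derive (v2 m) t) with (Derive (fun s => v2 m s) t) in e2.
rewrite Dy in e1. rewrite Dx in e2.
assert (dpx : is_derive (mom_x rad a lam1 m) t (lam * v2 m t)).
{ match type of e1 with _ = _ - lam1 * (?d - _) =>
    replace (lam * v2 m t) with
      (a * Derive (fun s => v1 m s) t + lam1 * (d - dy')) by lra end.
  apply (is_derive_plus (fun s => a * v1 m s)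
    (fun s => lam1 * (inv_y rad (x1 m s) (y1 m s) - y1 m s)));
    apply is_derive_scal.
  - now apply Derive_correct.
  - exact (is_derive_minus _ _ _ _ _ dyt dy). }
assert (dpy : is_derive (mom_y rad a lam1 m) t (- lam * v1 m t)).
{ match type of e2 with _ = _ + lam1 * (?d - _) =>
    replace (- lam * v1 m t) with
      (a * Derive (fun s => v2 m s) t - lam1 * (d - dx')) by lra end.
  apply (is_derive_minus (fun s => a * v2 m s)
    (fun s => lam1 * (inv_x rad (x1 m s) (y1 m s) - x1 m s)));
    apply is_derive_scal.
  - now apply Derive_correct.
  - exact (is_derive_minus _ _ _ _ _ dxt dx). }
assert (drh : is_derive (rho m) t drho).
{ unfold rho. auto_derive.
  - repeat split; [eexists; exact dx | eexists; exact dy].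
  - rewrite Dx, Dy. unfold drho. ring. }
(* The arctangent terms of the gradient are orthogonal to the vector to the vortex; only [- V] and
   the dipole term contribute to [drho]. *)
assert (edrho : drho * rho m t
  = 2 * (rad ^ 2 - rho m t) * (x1 m t * v1 m t + y1 m t * v2 m t)).
{ unfold drho, dx', dy', rho in *. field. lra. }
assert (Dpx : Derive (fun s => mom_x rad a lam1 m s) t = lam * v2 m t)
  by exact (is_derive_unique _ _ _ dpx).
assert (Dpy : Derive (fun s => mom_y rad a lam1 m s) t = - lam * v1 m t)
  by exact (is_derive_unique _ _ _ dpy).
assert (Drh : Derive (fun s => rho m s) t = drho)
  by exact (is_derive_unique _ _ _ drh).
split; [|split; [|split]].
- auto_derive.
  + repeat split; eexists; eassumption.
  + rewrite Dpx, Dyc. ring.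
- auto_derive.
  + repeat split; eexists; eassumption.
  + rewrite Dpy, Dxc. ring.
- auto_derive.
  + repeat split; eexists; eassumption.
  + rewrite Dpx, Dpy, Drh.
    unfold mom_x, mom_y, inv_x, inv_y. fold (rho m t).
    apply (Rmult_eq_reg_r (rho m t)); [|lra].
    transitivity (2 * lam * lam1 * (rad ^ 2 - rho m t) *
      (x1 m t * v1 m t + y1 m t * v2 m t) - lam * lam1 * (drho * rho m t)).
    * field. lra.
    * rewrite edrho. ring.
- unfold energy. auto_derive.
  + repeat split; try lra; trivial; eexists; eassumption.
  + rewrite Drh.
    match goal with |- ?l = _ => transitivity
      (2 * (v1 m t * (a * Derive (fun s => v1 m s) t)
          + v2 m t * (a * Derive (fun s => v2 m s) t))
        + lam1 ^ 2 * drho / (rho m t - rad ^ 2)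
        - lam * lam1 * drho / rho m t); [field; lra|] end.
    rewrite e1, e2. unfold drho, dx', dy', rho in *. clear - hrho hr2. field. lra.
Qed.

(** * A bound on the distance to the vortex *)

Lemma ln_le_sqrt (u : R) : 1 <= u -> 0 <= ln u <= 2 * sqrt u.
Proof.
intros hu.
assert (hs : 0 < sqrt u) by (apply sqrt_lt_R0; lra).
split.
- rewrite <- ln_1. apply ln_le; lra.
- pose proof (exp_ineq1_le (ln (sqrt u))) as h.
  rewrite exp_ln in h by trivial.
  rewrite <- (sqrt_sqrt u) at 1 by lra.
  rewrite ln_mult by trivial. lra.
Qed.

(** Here [T] stands for [a |V|^2]. For [2 * R2 <= r] the term [k * ln (r - R2)] is bounded below,
    and [l * ln r], of either sign, grows slower than [sqrt r]; this crude rate is enough later. *)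
Lemma kinetic_energy_bound (R2 k l h : R) :
  0 < R2 -> 0 <= k ->
  exists K0 K1 : R, 0 <= K0 /\ 0 <= K1 /\ forall T r : R, 2 * R2 <= r ->
    T + k * ln (r - R2) - l * ln r = h -> T <= K0 + K1 * sqrt r.
Proof.
intros hR2 hk.
exists (Rabs h + (k + Rabs l) * Rabs (ln R2)), (2 * Rabs l / sqrt R2).
assert (hs : 0 < sqrt R2) by (apply sqrt_lt_R0; lra).
pose proof (Rabs_pos h). pose proof (Rabs_pos l).
pose proof (Rabs_pos (ln R2)).
split; [nra|].
split; [apply Rmult_le_pos; [lra | now apply Rlt_le, Rinv_0_lt_compat]|].
intros T r hr e.
assert (h1 : ln R2 <= ln (r - R2)) by (apply ln_le; lra).
assert (hu : 1 <= r / R2).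
{ apply (Rmult_le_reg_r R2); trivial. replace (r / R2 * R2) with r
    by (field; lra). lra. }
assert (h2 : ln r = ln R2 + ln (r / R2)).
{ rewrite <- ln_mult; [f_equal; field; lra | trivial | lra]. }
destruct (ln_le_sqrt _ hu) as [h3 h4].
rewrite sqrt_div_alt in h4 by trivial.
assert (h5 : l * ln r <= Rabs l * (Rabs (ln R2) + 2 * (sqrt r / sqrt R2))).
{ apply Rle_trans with (1 := Rle_abs _). rewrite Rabs_mult.
  apply Rmult_le_compat_l; trivial. rewrite h2.
  apply Rle_trans with (1 := Rabs_triang _ _).
  rewrite (Rabs_pos_eq (ln (r / R2))) by trivial. lra. }
assert (h6 : - (k * Rabs (ln R2)) <= k * ln (r - R2)).
{ pose proof (Rle_abs (- ln R2)) as h7. rewrite Rabs_Ropp in h7. nra. }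
pose proof (Rle_abs h).
replace (2 * Rabs l / sqrt R2 * sqrt r)
  with (Rabs l * (2 * (sqrt r / sqrt R2))) by (field; lra).
lra.
Qed.

Lemma le_linear_sqrt_bounded (d A B : R) :
  0 < d -> 0 <= A -> 0 <= B ->
  exists S : R, 0 <= S /\ forall r : R, 0 <= r ->
    d * r <= A + B * sqrt r -> r <= S.
Proof.
intros hd hA hB.
(* The summand 1 covers [sqrt r <= 1]; otherwise [A + B * sqrt r <= (A + B) * sqrt r], and one
   factor [sqrt r] cancels. *)
exists ((1 + (A + B) / d) ^ 2).
split; [apply pow2_ge_0|].
intros r hr h.
rewrite <- (pow2_sqrt r) by trivial.
pose proof (sqrt_pos r) as hs.
assert (0 <= (A + B) / d)
  by (apply Rmult_le_pos; [lra | now apply Rlt_le, Rinv_0_lt_compat]).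
apply pow_incr; split; trivial.
destruct (Rle_lt_dec (sqrt r) 1) as [h1|h1]; [lra|].
rewrite <- (sqrt_sqrt r) in h at 1 by trivial.
assert (h2 : sqrt r * d <= A + B) by nra.
apply Rle_trans with ((A + B) / d); [|lra].
apply (Rmult_le_reg_r d); trivial.
replace ((A + B) / d * d) with (A + B) by (field; lra). lra.
Qed.

Lemma distance_bound (R2 a lam lam1 h i : R) :
  0 < R2 -> 0 < a -> lam1 <> 0 -> lam <> lam1 ->
  exists S : R, 0 <= S /\ forall u v x y : R,
    let r := x ^ 2 + y ^ 2 in
    let px := a * u + lam1 * (R2 / r * y - y) in
    let py := a * v - lam1 * (R2 / r * x - x) in
    R2 < r ->
    a * (u ^ 2 + v ^ 2) + lam1 ^ 2 * ln (r - R2) - lam * lam1 * ln r = h ->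
    px ^ 2 + py ^ 2 - lam * lam1 * r = i ->
    r <= S.
Proof.
intros hR2 ha hlam1 hne.
(* Up to sign, [d] is the coefficient of [r] in [|P|^2 - lam lam1 r] for large [r]. *)
set (d := Rabs (lam1 * (lam - lam1))).
assert (hd : 0 < d).
{ apply Rabs_pos_lt. intros e. apply Rmult_integral in e. lra. }
destruct (kinetic_energy_bound R2 (lam1 ^ 2) (lam * lam1) h hR2
  (pow2_ge_0 _)) as (K0 & K1 & hK0 & hK1 & hK).
(* [c] collects the multiples of [a |V|^2] coming from [|a V|^2] and from the AM-GM bound on the
   cross term. *)
set (c := a * (1 + 2 * lam1 ^ 2 / d)).
assert (hc : 0 <= c).
{ apply Rmult_le_pos; [lra|]. apply Rplus_le_le_0_compat; [lra|].
  apply Rmult_le_pos; [pose proof (pow2_ge_0 lam1); lra |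
    now apply Rlt_le, Rinv_0_lt_compat]. }
(* AM-GM uses up half of [d * r]; [2 * R2 * lam1 ^ 2] is the cost of replacing [q ^ 2 * r] by
   [r]. *)
destruct (le_linear_sqrt_bounded (d / 2)
  (Rabs i + 2 * R2 * lam1 ^ 2 + c * K0) (c * K1)) as (S & hS0 & hS).
- lra.
- pose proof (Rabs_pos i). pose proof (pow2_ge_0 lam1). nra.
- nra.
- exists (S + 2 * R2). split; [lra|].
  intros u v x y r px py hr eh ei.
  destruct (Rle_lt_dec r (2 * R2)) as [h2|h2]; [lra|].
  enough (r <= S) by lra.
  apply hS; [lra|].
  apply Rlt_le in h2. pose proof (hK _ _ h2 eh) as hT.
  (* A scalar here: the inverse point minus [(x, y)] is [- q] times [(x, y)]. *)
  set (q := 1 - R2 / r).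
  assert (hq : 0 <= q <= 1).
  { assert (0 < R2 / r) by (apply Rdiv_lt_0_compat; lra).
    assert (R2 / r <= 1).
    { apply (Rmult_le_reg_r r); [lra|].
      replace (R2 / r * r) with R2 by (field; lra). lra. }
    unfold q. lra. }
  assert (hq2 : q ^ 2 <= 1) by (clear - hq; nra).
  assert (hqr : r - 2 * R2 <= q ^ 2 * r <= r).
  { split; [|rewrite <- (Rmult_1_l r) at 2; apply Rmult_le_compat_r; lra].
    replace (q ^ 2 * r) with (r - 2 * R2 + R2 ^ 2 / r)
      by (unfold q; field; lra).
    assert (0 < R2 ^ 2 / r) by (apply Rdiv_lt_0_compat; nra). lra. }
  set (X := a * lam1 * q * (v * x - u * y)).
  assert (eX : px ^ 2 + py ^ 2
    = a * (a * (u ^ 2 + v ^ 2)) + 2 * X + lam1 ^ 2 * (q ^ 2 * r)).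
  { unfold px, py, X. replace (R2 / r) with (1 - q) by (unfold q; ring).
    unfold r. ring. }
  (* AM-GM: [2 |X| <= d r / 2 + 2 X^2 / (d r)], and
     [X^2 <= (a lam1)^2 (u^2 + v^2) r] by Cauchy-Schwarz. *)
  assert (hX : 2 * Rabs X <= d / 2 * r
    + 2 * lam1 ^ 2 / d * (a * (a * (u ^ 2 + v ^ 2)))).
  { assert (hX2 : X ^ 2 <= (a * lam1) ^ 2 * ((u ^ 2 + v ^ 2) * r)).
    { unfold X. replace ((a * lam1 * q * (v * x - u * y)) ^ 2)
        with ((a * lam1) ^ 2 * (q ^ 2 * (v * x - u * y) ^ 2)) by ring.
      apply Rmult_le_compat_l; [apply pow2_ge_0|].
      apply Rle_trans with (1 * (v * x - u * y) ^ 2).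
      - apply Rmult_le_compat_r; [apply pow2_ge_0 | trivial].
      - pose proof (pow2_ge_0 (u * x + v * y)). unfold r. lra. }
    pose proof (pow2_ge_0 (d * r - 2 * Rabs X)) as hsq.
    pose proof (pow2_abs X) as habs.
    apply (Rmult_le_reg_r (d * r)); [apply Rmult_lt_0_compat; lra|].
    replace ((d / 2 * r + 2 * lam1 ^ 2 / d * (a * (a * (u ^ 2 + v ^ 2))))
      * (d * r)) with ((d * r) ^ 2 / 2
      + 2 * ((a * lam1) ^ 2 * ((u ^ 2 + v ^ 2) * r))) by (field; lra).
    lra. }
  assert (hfinal : d * r <= Rabs i + 2 * R2 * lam1 ^ 2
    + a * (a * (u ^ 2 + v ^ 2)) + 2 * Rabs X).
  { rewrite <- (Rabs_pos_eq r) at 1 by lra. unfold d. rewrite <- Rabs_mult.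
    replace (lam1 * (lam - lam1) * r) with
      (- i + a * (a * (u ^ 2 + v ^ 2)) + 2 * X
       + lam1 ^ 2 * (q ^ 2 * r - r)) by lra.
    pose proof (pow2_ge_0 lam1).
    assert (0 <= a * (a * (u ^ 2 + v ^ 2)))
      by (repeat apply Rmult_le_pos; nra).
    assert (0 <= lam1 ^ 2 * (r - q ^ 2 * r) <= 2 * R2 * lam1 ^ 2) by nra.
    pose proof (Rle_abs i). pose proof (Rle_abs (- i)) as hi'.
    pose proof (Rle_abs X). pose proof (Rle_abs (- X)) as hX'.
    rewrite Rabs_Ropp in hi', hX'.
    apply Rabs_le. lra. }
  assert (hcT : c * (a * (u ^ 2 + v ^ 2)) <= c * (K0 + K1 * sqrt r))
    by (apply Rmult_le_compat_l; trivial).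
  unfold c in hcT at 1. lra.
Qed.

(** * Boundedness of the cylinder's path *)

Lemma constant_of_zero_derive (alpha beta : Rbar) (f : R -> R) (t0 t : R) :
  (forall s : R, Rbar_lt alpha s -> Rbar_lt s beta -> is_derive f s 0) ->
  Rbar_lt alpha t0 -> Rbar_lt t0 beta -> Rbar_lt alpha t -> Rbar_lt t beta ->
  f t = f t0.
Proof.
intros hf h0a h0b ha hb.
assert (key : forall u v : R, Rbar_lt alpha u -> Rbar_lt v beta -> u < v ->
  f u = f v).
{ intros u v hu hv huv. apply (eq_is_derive f); trivial.
  intros s hs. apply hf.
  - now apply Rbar_lt_le_trans with u.
  - now apply Rbar_le_lt_trans with v. }
destruct (Rtotal_order t t0) as [h|[->|h]]; trivial; [|symmetry]; auto.
Qed.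

Theorem proposition4 (rad a lam lam1 : R)
    (hrad : 0 < rad) (ha : 0 < a) (hlam1 : lam1 <> 0)
    (hlam_lam1 : lam <> lam1) (hlam : lam <> 0)
    (alpha beta : Rbar) (m : motion)
    (hm : is_solution rad a lam lam1 alpha beta m) :
  exists C : R, forall t : R, Rbar_lt alpha t -> Rbar_lt t beta ->
    sqrt (xc m t ^ 2 + yc m t ^ 2) <= C.
Proof.
destruct (classic (exists t0 : R, Rbar_lt alpha t0 /\ Rbar_lt t0 beta))
  as [(t0 & h0a & h0b)|hempty].
2: { exists 0. intros t hta htb. exfalso. eauto. }
assert (hrho : forall s : R, Rbar_lt alpha s -> Rbar_lt s beta ->
  rad ^ 2 < rho m s).
{ intros s hsa hsb. apply square_lt_of_lt_sqrt; [lra | now apply hm]. }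
assert (hder : forall s : R, Rbar_lt alpha s -> Rbar_lt s beta -> _)
  by (intros s hsa hsb; exact (integrals_derive rad a lam lam1 m s hrad
        (Rgt_not_eq _ _ ha) (hrho s hsa hsb) (proj2 (hm s hsa hsb)))).
pose (cx := mom_x rad a lam1 m t0 - lam * yc m t0).
pose (cy := mom_y rad a lam1 m t0 + lam * xc m t0).
pose (i := mom_x rad a lam1 m t0 ^ 2 + mom_y rad a lam1 m t0 ^ 2
           - lam * lam1 * rho m t0).
pose (h := energy rad a lam lam1 m t0).
assert (hr2 : 0 < rad ^ 2) by now apply pow_lt.
destruct (distance_bound (rad ^ 2) a lam lam1 h i hr2 ha hlam1 hlam_lam1)
  as (S & hS0 & hS).
(* The first integral gives [lam r_c = (cy - py, px - cx)], so [lam^2 |r_c|^2] is at most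
   [2 (|P|^2 + cx^2 + cy^2)], where [|P|^2 = i + lam lam1 rho] and [rho <= S]. *)
exists (sqrt (2 * (Rabs i + Rabs (lam * lam1) * S + cx ^ 2 + cy ^ 2)
              / lam ^ 2)).
intros t hta htb.
pose proof (fun f hf => constant_of_zero_derive alpha beta f t0 t hf
  h0a h0b hta htb) as hconst.
assert (ex : mom_x rad a lam1 m t - lam * yc m t = cx).
{ apply (hconst (fun s => mom_x rad a lam1 m s - lam * yc m s)). apply hder. }
assert (ey : mom_y rad a lam1 m t + lam * xc m t = cy).
{ apply (hconst (fun s => mom_y rad a lam1 m s + lam * xc m s)). apply hder. }
assert (ei : mom_x rad a lam1 m t ^ 2 + mom_y rad a lam1 m t ^ 2
             - lam * lam1 * rho m t = i).
{ apply (hconst (fun s => mom_x rad a lam1 m s ^ 2 + mom_y rad a lam1 m s ^ 2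
             - lam * lam1 * rho m s)). apply hder. }
assert (eh : energy rad a lam lam1 m t = h).
{ apply hconst. apply hder. }
pose proof (hrho t hta htb) as hout.
assert (hrS : rho m t <= S) by exact (hS _ _ _ _ hout eh ei).
assert (hlam2 : 0 < lam ^ 2) by (apply pow2_gt_0; trivial).
apply sqrt_le_1_alt. apply (Rmult_le_reg_r (lam ^ 2)); trivial.
replace (2 * (Rabs i + Rabs (lam * lam1) * S + cx ^ 2 + cy ^ 2)
              / lam ^ 2 * lam ^ 2)
  with (2 * (Rabs i + Rabs (lam * lam1) * S + cx ^ 2 + cy ^ 2))
  by (field; trivial).
assert (hi : lam * lam1 * rho m t <= Rabs (lam * lam1) * S).
{ apply Rle_trans with (1 := Rle_abs _). rewrite Rabs_mult.
  rewrite (Rabs_pos_eq (rho m t)) by lra.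
  apply Rmult_le_compat_l; trivial. apply Rabs_pos. }
pose proof (Rle_abs i).
set (px := mom_x rad a lam1 m t) in *. set (py := mom_y rad a lam1 m t) in *.
replace ((xc m t ^ 2 + yc m t ^ 2) * lam ^ 2)
  with ((cy - py) ^ 2 + (px - cx) ^ 2) by (rewrite <- ex, <- ey; ring).
(* These squares give [(cy - py)^2 <= 2 (cy^2 + py^2)] and its analogue for [px], [cx]. *)
pose proof (pow2_ge_0 (cy + py)). pose proof (pow2_ge_0 (px + cx)).
lra.
Qed.
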